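(* Let $\mathfrak{g}$ be a real quasi-filiform Lie algebra admitting a complex structure. Then $\mathfrak{g}$ is isomorphic either to the $4$-dimensional algebra $\mathfrak{L}_3\oplus\mathbb{R}$, with basis $X_0,X_1,X_2,X_3$ and only nonzero brackets $[X_0,X_1]=X_2$ (up to antisymmetry), or to the $6$-dimensional algebra $\mathfrak{n}_{6,3}$, with basis $X_0,\dots,X_5$ and only nonzero brackets (up to antisymmetry) $[X_0,X_i]=X_{i+1}$ for $i=1,2,3$, $[X_1,X_2]=X_5$, $[X_1,X_5]=X_4$.
   Context: Lower central series: $\mathfrak{g}^0=\mathfrak{g}$, $\mathfrak{g}^i=[\mathfrak{g}^{i-1},\mathfrak{g}]$; the nilindex of a nilpotent Lie algebra is the least $m$ with $\mathfrak{g}^m=0$. A nilpotent Lie algebra is quasi-filiform if its nilindex equals $\dim\mathfrak{g}-2$. A complex structure on a real Lie algebra $\mathfrak{g}$ (of even dimension) is a linear endomorphism $J$ with $J^2=-\mathrm{Id}$ and $[JX,JY]-[X,Y]-J[JX,Y]-J[X,JY]=0$ for all $X,Y\in\mathfrak{g}$. *)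

(* Defs.v *)
From HB Require Import structures.
From mathcomp Require Import all_boot all_order all_algebra.
From mathcomp Require Import reals.
Set Implicit Arguments. Unset Strict Implicit. Unset Printing Implicit Defensive.
Import Order.TTheory GRing.Theory Num.Theory.
Local Open Scope ring_scope.

Section LieDefs.
Variables (R : realType) (V : vectType R).

Definition lie_algebra (br : V -> V -> V) : Prop :=
  [/\ (forall (a : R) x y z, br (a *: x + y) z = a *: br x z + br y z),
      (forall (a : R) x y z, br z (a *: x + y) = a *: br z x + br z y),
      (forall x, br x x = 0) &
      (forall x y z, br x (br y z) + br y (br z x) + br z (br x y) = 0)].

(* [U, W] : the subspace spanned by brackets (of basis vectors; by
   bilinearity this is the span of all brackets [u, w], u in U, w in W). *)
Definition bracket_space (br : V -> V -> V) (U W : {vspace V}) : {vspace V} :=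
  (<<[seq br u w | u <- vbasis U, w <- vbasis W]>>)%VS.

Definition lcs (br : V -> V -> V) (i : nat) : {vspace V} :=
  iter i (fun U => bracket_space br U fullv) fullv.

Definition is_nilindex (br : V -> V -> V) (m : nat) : Prop :=
  lcs br m = 0%VS /\ (forall k, (k < m)%N -> lcs br k != 0%VS).

Definition quasi_filiform (br : V -> V -> V) : Prop :=
  exists m, is_nilindex br m /\ (m + 2 = \dim (fullv : {vspace V}))%N.

Definition complex_structure (br : V -> V -> V) (J : 'End(V)) : Prop :=
  (forall x, J (J x) = - x) /\
  (forall x y, br (J x) (J y) - br x y - J (br (J x) y) - J (br x (J y)) = 0).

End LieDefs.

Definition lie_iso (R : realType) (V W : vectType R)
  (br : V -> V -> V) (br' : W -> W -> W) : Prop :=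
  exists f : 'Hom(V, W), bijective f /\ forall x y, f (br x y) = br' (f x) (f y).

(* structure constants from a list of triples (i, j, k) meaning [X_i, X_j] = X_k,
   extended by antisymmetry *)
Definition lie_sc (R : realType) (l : seq (nat * nat * nat)) (i j k : nat) : R :=
  (((i, j, k) \in l) : nat)%:R - (((j, i, k) \in l) : nat)%:R.

Definition sc_bracket (R : realType) (n : nat) (l : seq (nat * nat * nat))
  (u v : 'rV[R]_n) : 'rV[R]_n :=
  \row_k \sum_(i < n) \sum_(j < n) u 0 i * v 0 j * lie_sc R l i j k.

Definition L3R_bracket (R : realType) := @sc_bracket R 4 [:: (0, 1, 2)]%N.

Definition n63_bracket (R : realType) :=
  @sc_bracket R 6 [:: (0, 1, 2); (0, 2, 3); (0, 3, 4); (1, 2, 5); (1, 5, 4)]%N.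

(* Main.v *)
(* Write g^j for the lower central series, dim g = m + 2, and let
   W_j = g^j + J g^j be the smallest J-stable subspace containing g^j; W_j has
   even dimension.  Integrability gives [W_j, W_j] <= W_(j+1), so W_1 <> g by
   nilpotency, and [Ju, y] = J [u, y] mod W_(j+1) for y in W_j.  If
   W_(j-1) = W_j the latter yields W_j = g^j + W_(j+1), so by parity
   W_j = W_(j+1) as soon as dim g^j / g^(j+1) <= 1; hence once the drops of g^j
   are at most 1, two equal consecutive W's must be 0.  Since W_1 has
   codimension 2, two cases remain.
   - dim g^1 = m - 1: all later drops are 1, parity gives W_2 = g^2 = W_3,
     hence g^2 = 0 and dim g = 4.
   - dim g^1 = m: g^1 is J-stable and exactly one later drop, from g^k to
     g^(k+1), equals 2.  Here W_k = g^1 and g^k meets W_(k+1) in g^(k+1), so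
     brackets of g^1 that land in g^k land in g^(k+1); this forces k = 2.  Then
     W_4 = g^4 = W_5 by parity, hence g^4 = 0 and dim g = 6.
   In both cases u, Ju generate g for u outside W_1, and the brackets are read
   off from the integrability condition at (u, J z) with z central. *)

Require Import Defs.
From HB Require Import structures.
From mathcomp Require Import all_boot all_order all_algebra.
From mathcomp Require Import reals.
From mathcomp Require Import zify.
Set Implicit Arguments. Unset Strict Implicit. Unset Printing Implicit Defensive.
Import Order.TTheory GRing.Theory Num.Theory.
Local Open Scope ring_scope.

(* The matrix M of J on U satisfies M^2 = -1, so (det M)^2 = (-1)^(dim U). *)
Lemma dim_stable_even (R : realType) (V : vectType R) (J : 'End(V))
    (U : {vspace V}) :
  (forall x, J (J x) = - x) -> (forall x, x \in U -> J x \in U) ->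
  ~~ odd (\dim U).
Proof.
move=> JJ JU; pose e := vbasis U; pose d := \dim U.
pose M : 'M[R]_d := \matrix_(i, j) coord e j (J e`_i).
have eU (i : 'I_d) : e`_i \in U by rewrite vbasis_mem ?mem_nth ?size_tuple.
have freee : free e by apply: basis_free (vbasisP U).
have MM : M *m M = (-1)%:M.
  apply/matrixP=> i k; rewrite !mxE.
  rewrite -[RHS](_ : coord e k (J (J e`_i)) = _); last first.
    by rewrite JJ linearN /= coord_free // eq_sym mulNrn.
  have {1}-> := coord_vbasis (JU _ (eU i)); rewrite !linear_sum /=.
  by apply: eq_bigr => j _; rewrite !linearZ /= !mxE.
have: 0 <= (\det M) ^+ 2 by apply: sqr_ge0.
rewrite expr2 -det_mulmx MM det_scalar -signr_odd.
by case: (odd _); rewrite // expr1 ler0N1.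
Qed.

(** * Coordinate vectors with respect to a tuple *)

Section CoordRow.
Variables (R : realType) (V : vectType R) (n : nat) (X : n.-tuple V).

Definition coord_row (v : V) : 'rV[R]_n := \row_i coord X i v.

Fact coord_row_is_linear : linear coord_row.
Proof. by move=> a u v; apply/rowP => i; rewrite !mxE linearP. Qed.

HB.instance Definition _ :=
  GRing.isLinear.Build R V 'rV[R]_n _ coord_row coord_row_is_linear.

End CoordRow.

(** * Bracket calculus and the lower central series *)

Section LieTheory.

Variables (R : realType) (V : vectType R) (br : V -> V -> V).
Hypothesis lie : lie_algebra br.

Local Notation g := (lcs br).

Lemma brDl x y z : br (x + y) z = br x z + br y z.
Proof. by case: lie => h _ _ _; have := h 1 x y z; rewrite !scale1r. Qed.

Lemma brDr x y z : br z (x + y) = br z x + br z y.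
Proof. by case: lie => _ h _ _; have := h 1 x y z; rewrite !scale1r. Qed.

Lemma br0l z : br 0 z = 0.
Proof. by apply: (addrI (br 0 z)); rewrite -brDl !addr0. Qed.

Lemma br0r z : br z 0 = 0.
Proof. by apply: (addrI (br z 0)); rewrite -brDr !addr0. Qed.

Lemma brZl a x z : br (a *: x) z = a *: br x z.
Proof. by case: lie => h _ _ _; have := h a x 0 z; rewrite br0l !addr0. Qed.

Lemma brZr a x z : br z (a *: x) = a *: br z x.
Proof. by case: lie => _ h _ _; have := h a x 0 z; rewrite br0r !addr0. Qed.

Lemma brNl x z : br (- x) z = - br x z.
Proof. by rewrite -scaleN1r brZl scaleN1r. Qed.

Lemma brNr x z : br z (- x) = - br z x.
Proof. by rewrite -scaleN1r brZr scaleN1r. Qed.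

Lemma brxx x : br x x = 0. Proof. by case: lie. Qed.

Lemma brC x y : br x y = - br y x.
Proof.
apply/eqP; rewrite -addr_eq0; apply/eqP.
by have := brxx (x + y); rewrite brDl !brDr !brxx add0r addr0.
Qed.

Lemma br_jacobi x y z : br (br x y) z = br x (br y z) - br y (br x z).
Proof.
case: lie => _ _ _ /(_ x y z); rewrite (brC z x) brNr (brC z).
by move/eqP; rewrite subr_eq0 => /eqP.
Qed.

Lemma br_suml (I : Type) (r : seq I) (F : I -> V) z :
  br (\sum_(i <- r) F i) z = \sum_(i <- r) br (F i) z.
Proof.
by elim: r => [|i r IH]; rewrite ?big_nil ?br0l // !big_cons brDl IH.
Qed.

Lemma br_sumr (I : Type) (r : seq I) (F : I -> V) z :
  br z (\sum_(i <- r) F i) = \sum_(i <- r) br z (F i).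
Proof.
by elim: r => [|i r IH]; rewrite ?big_nil ?br0r // !big_cons brDr IH.
Qed.

Lemma mem_bracket_space (U W : {vspace V}) u w :
  u \in U -> w \in W -> br u w \in bracket_space br U W.
Proof.
move=> uU wW; rewrite (coord_vbasis uU) (coord_vbasis wW) br_suml.
apply: memv_suml => i _; rewrite br_sumr; apply: memv_suml => j _.
rewrite brZl brZr !memvZ //; apply: memv_span.
by apply: allpairs_f; rewrite mem_nth ?size_tuple.
Qed.

Lemma bracket_space_sub (U W Z : {vspace V}) :
  (forall u w, u \in U -> w \in W -> br u w \in Z) ->
  (bracket_space br U W <= Z)%VS.
Proof.
move=> h; apply/span_subvP => _ /allpairsP[[u w] /= [uU wW ->]].
by apply: h; exact: vbasis_mem.
Qed.

Lemma lcsS_mem j x y : x \in g j -> br x y \in g j.+1.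
Proof. by move=> xg; apply: mem_bracket_space => //; exact: memvf. Qed.

Lemma lcsS_memr j x y : y \in g j -> br x y \in g j.+1.
Proof. by move=> yg; rewrite brC memvN lcsS_mem. Qed.

Lemma lcsS_sub j (Z : {vspace V}) :
  (forall x y, y \in g j -> br x y \in Z) -> (g j.+1 <= Z)%VS.
Proof.
by move=> h; apply: bracket_space_sub => u w ug _; rewrite brC memvN h.
Qed.

Lemma lcs_subS j : (g j.+1 <= g j)%VS.
Proof.
elim: j => [|j IH]; first exact: subvf.
by apply: lcsS_sub => x y yg; apply: lcsS_memr; apply: (subvP IH).
Qed.

Lemma lcs_sub i j : (i <= j)%N -> (g j <= g i)%VS.
Proof.
move=> /subnK <-; elim: (j - i)%N => [|k IH]; first exact: subvv.
exact: subv_trans (lcs_subS _) IH.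
Qed.

Lemma bracket_space_brl (U W Z : {vspace V}) y :
  (forall u w, br (br u w) y \in Z) ->
  forall x, x \in bracket_space br U W -> br x y \in Z.
Proof.
move=> h x; rewrite /bracket_space; set s := [seq _ | _ <- _, _ <- _] => xs.
rewrite (coord_span (xs : x \in <<in_tuple s>>%VS)) br_suml.
apply: memv_suml => i _; rewrite brZl memvZ //.
by have /allpairsP[[a b] /= [_ _ ->]] := mem_nth 0 (ltn_ord i).
Qed.

(** By Jacobi, [[a, b], y] is a difference of double brackets of y, and each bracket moves y one
    step down the series. *)
Lemma lcs1_br j x y : x \in g 1 -> y \in g j -> br x y \in g j.+2.
Proof.
move=> xg yg; apply: bracket_space_brl xg => a b.
by rewrite br_jacobi memvB ?lcsS_memr.
Qed.

(** Modulo Z, the bracket of aP + bQ + r and cP + dQ + t is (ad - bc)[P, Q]. It serves both for U =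
    g^1, Z = g^2 and for U = W_1, Z = 0. *)
Lemma lcs1_sub P Q (U Z : {vspace V}) :
  (fullv <= <[P]> + <[Q]> + U)%VS -> (forall x y, y \in U -> br x y \in Z) ->
  (g 1 <= <[br P Q]> + Z)%VS.
Proof.
move=> gen UZ; apply: lcsS_sub => x y _.
have /memv_addP[_ /memv_addP[_ /vlineP[a ->] [_ /vlineP[b ->] ->]] [r rU ->]] :=
  subvP gen _ (memvf x).
have /memv_addP[_ /memv_addP[_ /vlineP[c ->] [_ /vlineP[d ->] ->]] [t tU ->]] :=
  subvP gen _ (memvf y).
rewrite brDr memvD ?(subvP (addvSr _ _) _ (UZ _ _ tU)) //.
rewrite brDl memvD //; last first.
  by rewrite brC memvN (subvP (addvSr _ _)) ?UZ.
rewrite brDl !brDr !brZl !brZr !brxx !scaler0 add0r addr0 (brC Q).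
rewrite (subvP (addvSl _ _)) // !scalerN !scalerA -scaleNr -scalerDl.
by rewrite memvZ // memv_line.
Qed.

Lemma lcs2_sub P Q :
  (fullv <= <[P]> + <[Q]> + g 1)%VS -> (g 1 <= <[br P Q]> + g 2)%VS.
Proof. by move=> gen; apply: lcs1_sub gen _ => x y; apply: lcsS_memr. Qed.

(** The g^1 component of the acting element contributes only to g^(j+2), by [lcs1_br]. *)
Lemma lcs_step P Q Y j : Y \in g j ->
  (fullv <= <[P]> + <[Q]> + g 1)%VS -> (g j <= <[Y]> + g j.+1)%VS ->
  (g j.+1 <= <[br P Y]> + <[br Q Y]> + g j.+2)%VS.
Proof.
move=> Yg gen genj; apply: lcsS_sub => x y /(subvP genj).
case/memv_addP=> _ /vlineP[c ->] [t tg ->].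
have /memv_addP[_ /memv_addP[_ /vlineP[a ->] [_ /vlineP[b ->] ->]] [r rg ->]] :=
  subvP gen _ (memvf x).
rewrite brDr memvD ?(subvP (addvSr _ _) _ (lcsS_memr _ tg)) // brZr memvZ //.
by rewrite !brDl !brZl !memv_add ?lcs1_br ?memvZ ?memv_line.
Qed.

Lemma lcs_stop i : g i = g i.+1 -> forall j, (i <= j)%N -> g j = g i.
Proof.
move=> e j /subnK <-; elim: (j - i)%N => [//|k IH].
by rewrite addSn [LHS]/= -/(lcs br _) IH -[RHS]/(g i) {2}e.
Qed.

(** * Isomorphisms from structure constants *)

(** The isomorphism is the coordinate map of the basis [X]; antisymmetry of both brackets reduces
    the check to i < j. *)
Lemma lie_iso_sc n l (X : n.-tuple V) :
  (fullv <= <<X>>)%VS -> \dim (fullv : {vspace V}) = n ->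
  (forall i j : 'I_n, (i < j)%N ->
     br X`_i X`_j = \sum_(k < n) lie_sc R l i j k *: X`_k) ->
  lie_iso br (@sc_bracket R n l).
Proof.
move=> spX dimV sc.
have bX : basis_of fullv X by rewrite basisEdim spX size_tuple dimV leqnn.
have fX := basis_free bX.
have sc' (i j : 'I_n) : br X`_i X`_j = \sum_(k < n) lie_sc R l i j k *: X`_k.
  case: (ltngtP i j) => [ij|ji|/val_inj->]; first exact: sc.
    rewrite brC sc // -sumrN; apply: eq_bigr => k _.
    by rewrite -scaleNr /lie_sc opprB.
  rewrite brxx big1 // => k _.
  by rewrite /lie_sc subrr scale0r.
have E x : x = \sum_(i < n) coord X i x *: X`_i.
  by apply: (coord_basis bX (memvf x)).
exists (linfun (coord_row X)); split.
  exists (fun w : 'rV_n => \sum_(i < n) w 0 i *: X`_i) => [x|w];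
    rewrite lfunE /=.
    by rewrite [RHS]E; apply: eq_bigr => i _; rewrite mxE.
  by apply/rowP => i; rewrite mxE coord_sum_free.
move=> x y; rewrite !lfunE /=; apply/rowP => k; rewrite !mxE.
rewrite {1}[x]E {1}[y]E br_suml linear_sum; apply: eq_bigr => i _.
rewrite br_sumr linear_sum; apply: eq_bigr => j _.
rewrite brZl brZr sc' scalerA linearZ /= coord_sum_free //.
by rewrite !mxE.
Qed.

Lemma L3R_iso x0 x1 x2 x3 :
  \dim (fullv : {vspace V}) = 4 -> (fullv <= <<[:: x0; x1; x2; x3]>>)%VS ->
  br x0 x1 = x2 -> br x0 x2 = 0 -> br x1 x2 = 0 -> (forall x, br x x3 = 0) ->
  lie_iso br (@L3R_bracket R).
Proof.
move=> dimV sp b01 b02 b12 b3.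
apply: (@lie_iso_sc 4 _ [tuple x0; x1; x2; x3]) => //.
case=> [[|[|[|[|//]]]] i4] [[|[|[|[|//]]]] j4] //= _.
all: rewrite !big_ord_recl big_ord0 /lie_sc /= !subr0.
all: by rewrite ?b01 ?b02 ?b12 ?b3 ?scale0r ?scale1r ?add0r ?addr0.
Qed.

Lemma n63_iso x0 x1 x2 x3 x4 x5 :
  \dim (fullv : {vspace V}) = 6 ->
  (fullv <= <<[:: x0; x1; x2; x3; x4; x5]>>)%VS ->
  br x0 x1 = x2 -> br x0 x2 = x3 -> br x0 x3 = x4 -> br x0 x5 = 0 ->
  br x1 x2 = x5 -> br x1 x3 = 0 -> br x1 x5 = x4 ->
  br x2 x3 = 0 -> br x2 x5 = 0 -> br x3 x5 = 0 -> (forall x, br x x4 = 0) ->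
  lie_iso br (@n63_bracket R).
Proof.
move=> dimV sp b01 b02 b03 b05 b12 b13 b15 b23 b25 b35 b4.
have b45 : br x4 x5 = 0 by rewrite brC b4 oppr0.
apply: (@lie_iso_sc 6 _ [tuple x0; x1; x2; x3; x4; x5]) => //.
case=> [[|[|[|[|[|[|//]]]]]] i6] [[|[|[|[|[|[|//]]]]]] j6] //= _.
all: rewrite !big_ord_recl big_ord0 /lie_sc /= !subr0.
all: by rewrite ?scale0r ?scale1r ?add0r ?addr0 ?b4.
Qed.

(** * The J-stable hulls W_j of the lower central series *)

Section Complex.

Variable J : 'End(V).
Hypothesis cpx : complex_structure br J.

Local Notation W j := (lcs br j + J @: lcs br j)%VS.

Lemma JJ x : J (J x) = - x. Proof. by case: cpx. Qed.

Lemma br_JJ x y : br (J x) (J y) = br x y + J (br (J x) y) + J (br x (J y)).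
Proof.
case: cpx => _ /(_ x y)/eqP; rewrite subr_eq0 !subr_eq => /eqP ->.
by rewrite addrC (addrC (J (br x _))) addrA.
Qed.

Lemma WP j x :
  reflect (exists a b, [/\ a \in g j, b \in g j & x = a + J b]) (x \in W j).
Proof.
apply: (iffP memv_addP) => [[a ag [_ /memv_imgP[b bg ->] ->]]|[a [b [ag bg ->]]]].
  by exists a, b.
by exists a => //; exists (J b) => //; apply: memv_img.
Qed.

Lemma lcs_subW j : (g j <= W j)%VS. Proof. exact: addvSl. Qed.

Lemma lcs_W j x : x \in g j -> x \in W j. Proof. exact/subvP/lcs_subW. Qed.

Lemma J_lcs_W j x : x \in g j -> J x \in W j.
Proof. by move=> xg; apply: (subvP (addvSr _ _)); apply: memv_img. Qed.

Lemma J_W j x : x \in W j -> J x \in W j.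
Proof.
case/WP=> a [b [ag bg ->]].
by rewrite linearD /= JJ memvB ?(J_lcs_W ag) ?(lcs_W bg).
Qed.

Lemma W_min j (U : {vspace V}) :
  (g j <= U)%VS -> (forall x, x \in U -> J x \in U) -> (W j <= U)%VS.
Proof.
move=> gU JU; rewrite subv_add gU; apply/subvP => _ /memv_imgP[x xg ->].
by apply: JU; apply: (subvP gU).
Qed.

Lemma W_sub i j : (i <= j)%N -> (W j <= W i)%VS.
Proof. by move=> ij; rewrite addvS ?limgS ?lcs_sub. Qed.

Lemma W_even j : ~~ odd (\dim (W j)).
Proof. exact: dim_stable_even JJ (@J_W j). Qed.

(** Only [Jb, Jd] has no factor in g^j; integrability rewrites it through brackets that do. *)
Lemma br_W j x y : x \in W j -> y \in W j -> br x y \in W j.+1.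
Proof.
move=> /WP[a [b [ag bg ->]]] /WP[c [d [cg dg ->]]].
rewrite brDl memvD ?(lcs_W (lcsS_mem _ ag)) // brDr.
rewrite memvD ?(lcs_W (lcsS_memr _ cg)) // br_JJ.
rewrite !memvD ?(lcs_W (lcsS_mem _ bg)) ?(J_lcs_W (lcsS_mem _ bg)) //.
exact: J_lcs_W (lcsS_memr _ dg).
Qed.

(** If W_1 = g = W_j, then W_(j+1) contains [g, g] = g^1, hence its J-stable hull W_1 = g. So every
    W_j would be g, against W_m = 0. *)
Lemma W1_neq m : g m = 0%VS -> fullv != 0%VS :> {vspace V} -> W 1 != fullv.
Proof.
move=> gm0 V0; apply: contraNneq V0 => W1.
suff Wf j : W j = fullv by rewrite -(Wf m) gm0 limg0 addv0.
elim: j => [|j IH]; first exact/addv_idPl/subvf.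
apply/subv_anti; rewrite subvf -[X in (X <= _)%VS]W1 W_min //; last exact: J_W.
by apply: lcsS_sub => x y _; rewrite br_W // IH memvf.
Qed.

(* Modulo [W j.+1], the map [u |-> ad u] is complex linear on [W j]. *)
Lemma br_J_W j u y : y \in W j -> br (J u) y - J (br u y) \in W j.+1.
Proof.
case/WP=> a [b [ag bg ->]]; rewrite !brDr br_JJ [J (_ + _)]linearD /=.
rewrite addrA (addrC (J (br u a))) addrKA memvB ?(J_lcs_W (lcsS_memr _ ag)) //.
rewrite !memvD ?(lcs_W (lcsS_memr _ ag)) ?(lcs_W (lcsS_memr _ bg)) //.
exact: J_lcs_W (lcsS_memr _ bg).
Qed.

(** For y in g^j, [br_J_W] at level j+1 gives J[u, y] = [Ju, y] modulo W_(j+2), and [Ju, y] is in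
    g^(j+1). *)
Lemma W_eq_lcs_add j : (g j <= W j.+1)%VS -> (W j.+1 <= g j.+1 + W j.+2)%VS.
Proof.
move=> gW; rewrite [X in (X <= _)%VS]/(W j.+1) subv_add addvSl /=.
apply/subvP => _ /memv_imgP[x xg ->].
suff /subvP/(_ _ xg) : (g j.+1 <= J @^-1: (g j.+1 + W j.+2))%VS.
  by rewrite -memv_preim.
apply: lcsS_sub => u y yg; rewrite -memv_preim -[J _](subrK (br (J u) y)).
rewrite memvD ?(subvP (addvSl _ _) _ (lcsS_memr _ yg)) //.
rewrite (subvP (addvSr _ _)) //.
by rewrite -memvN opprB br_J_W // (subvP gW).
Qed.

(** As g^(j+1) meets W_(j+2) in at least g^(j+2), W_(j+1) exceeds W_(j+2) by at most one dimension,
    hence by none, both being even. *)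
Lemma W_stationary j : W j = W j.+1 ->
  (\dim (g j.+1) <= (\dim (g j.+2)).+1)%N ->
  W j.+1 = W j.+2.
Proof.
move=> eW le1; have gW : (g j <= W j.+1)%VS by rewrite -eW lcs_subW.
have /dimvS := W_eq_lcs_add gW; have := W_even j.+1; have := W_even j.+2.
have := dimv_sum_cap (g j.+1) (W j.+2).
have : (\dim (g j.+2) <= \dim (g j.+1 :&: W j.+2)%VS)%N.
  by rewrite dimvS // subv_cap lcs_subS lcs_subW.
move=> h1 h2 h3 h4 h5; apply/eqP; rewrite eq_sym eqEdim W_sub //.
lia.
Qed.

Lemma W_vanish m j : g m = 0%VS -> W j = W j.+1 ->
  (forall i, (j < i)%N -> (\dim (g i) <= (\dim (g i.+1)).+1)%N) -> W j = 0%VS.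
Proof.
move=> gm0 eW le1.
have Wj i : (W (j + i)%N = W j) /\ (W (j + i).+1 = W j).
  elim: i => [|i [IH1 IH2]]; first by rewrite addn0.
  rewrite addnS; split=> //; rewrite -IH2; apply/esym/W_stationary.
    by rewrite IH1 IH2.
  by apply: le1; lia.
have [/esym-> _] := Wj m.
apply/eqP; rewrite -subv0 (subv_trans (W_sub (leq_addl j m))) //.
by rewrite gm0 limg0 addv0.
Qed.

Lemma add_lineJ_stable u j x : x \in (<[u]> + <[J u]> + W j)%VS ->
  J x \in (<[u]> + <[J u]> + W j)%VS.
Proof.
case/memv_addP=> _ /memv_addP[_ /vlineP[a ->] [_ /vlineP[b ->] ->]] [w wW ->].
rewrite linearD /= memv_add ?J_W // linearD !linearZ /= JJ addrC.
by rewrite memv_add ?memvZ ?memv_line // memvN memv_line.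
Qed.

(** Otherwise x would be a real eigenvector of J, with eigenvalue c satisfying c^2 = -1. *)
Lemma J_line_eq0 (U : {vspace V}) x :
  (\dim U <= 1)%N -> x \in U -> J x \in U -> x = 0.
Proof.
move=> U1 xU JxU; apply/eqP; apply: contraLR U1 => x0; rewrite -ltnNge.
have lU : (<[x]> <= U)%VS by rewrite -memvE.
apply: leq_ltn_trans (_ : (\dim <[x]> < _)%N); first by rewrite dim_vline x0.
rewrite ltnNge; apply/negP => le.
have /eqP e : <[x]>%VS == U by rewrite eqEdim lU.
move: JxU; rewrite -e => /vlineP[c Jx]; have := JJ x.
rewrite Jx linearZ /= Jx scalerA => /eqP.
rewrite -addr_eq0 -{2}[x]scale1r -scalerDl scaler_eq0 (negbTE x0) orbF.
by rewrite paddr_eq0 ?ler01 -?expr2 ?sqr_ge0 // oner_eq0 andbF.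
Qed.

(** * Recovering the brackets of the two algebras *)

Lemma br_center_J z : (forall p, br p z = 0) ->
  forall p, br (J p) (J z) = J (br p (J z)).
Proof. by move=> z0 p; rewrite br_JJ !z0 linear0 !add0r. Qed.

(** For z in the central line g^1, both [p, Jz] and J[p, Jz] = [Jp, Jz] lie in that line, so they
    vanish. Thus W_1 is central and [u, Ju] spans g^1. *)
Lemma iso_L3R u : \dim (fullv : {vspace V}) = 4 -> \dim (g 1) = 1%N ->
  g 2 = 0%VS -> (fullv <= <[u]> + <[J u]> + W 1)%VS ->
  lie_iso br (@L3R_bracket R).
Proof.
move=> dimV D1 g2 gen.
have cen z p : z \in g 1 -> br p z = 0.
  by move=> zg; apply/eqP; rewrite -memv0 -g2 lcsS_memr.
have br1 p q : br p q \in g 1 by apply: (@lcsS_mem 0); apply: memvf.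
have cenJ z p : z \in g 1 -> br p (J z) = 0.
  move=> zg; apply: (J_line_eq0 (U := g 1)); rewrite ?D1 ?br1 //.
  by rewrite -br_center_J // => q; apply: cen.
have cenW p x : x \in W 1 -> br p x = 0.
  by move=> /WP[a [b [ag bg ->]]]; rewrite brDr cen ?cenJ ?addr0.
have g1 : (g 1 <= <[br u (J u)]>)%VS.
  rewrite -[X in (_ <= X)%VS]addv0; apply: lcs1_sub gen _ => x y /cenW->.
  exact: mem0v.
apply: (@L3R_iso u (J u) (br u (J u)) (J (br u (J u)))) => //.
- set S := span _.
  have inS x : x \in [:: u; J u; br u (J u); J (br u (J u))] -> (<[x]> <= S)%VS.
    by move=> h; rewrite -memvE memv_span.
  apply: subv_trans gen _; rewrite !subv_add !inS ?inE ?eqxx ?orbT //=.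
  rewrite (subv_trans g1) ?inS ?inE ?eqxx ?orbT //=.
  by rewrite (subv_trans (limgS J g1)) // limg_line inS ?inE ?eqxx ?orbT.
- exact: cen.
- exact: cen.
- by move=> x; apply: cenJ.
Qed.

(** Apart from brackets that define basis vectors or vanish by depth, only [v, x3], [u, x5] and
    [v, x5] are open. All lie in the line g^3, where Jacobi and integrability determine them. *)
Lemma iso_n63 u : \dim (fullv : {vspace V}) = 6 -> \dim (g 3) = 1%N ->
  g 4 = 0%VS -> (g 1 <= g 2 + W 3)%VS -> (fullv <= <[u]> + <[J u]> + g 1)%VS ->
  lie_iso br (@n63_bracket R).
Proof.
move=> dimV D3 g4 g1W gen; set v := J u in gen.
have br1 p q : br p q \in g 1 by apply: (@lcsS_mem 0); apply: memvf.
have br12 x y : x \in g 1 -> y \in g 2 -> br x y = 0.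
  by move=> xg yg; apply/eqP; rewrite -memv0 -g4 lcs1_br.
have cen z p : z \in g 3 -> br p z = 0.
  by move=> zg; apply/eqP; rewrite -memv0 -g4 lcsS_memr.
pose x2 := br u v; pose x3 := br u x2; pose x5 := br v x2; pose x4 := br u x3.
have x2g : x2 \in g 1 by apply: br1.
have x3g : x3 \in g 2 by apply: lcsS_memr.
have x5g : x5 \in g 2 by apply: lcsS_memr.
have x4g : x4 \in g 3 by apply: lcsS_memr.
(* Brackets of w are in g^3, hence central; so x3 and x5 agree with A and J A up to central
   terms. *)
have [w [z [wg zg x2E]]] : exists w z, [/\ w \in g 2, z \in g 3 & x2 = w + J z].
  have /memv_addP[w wg [_ /WP[c [z [cg zg ->]]] ->]] := subvP g1W _ x2g.
  exists (w + c), z; split=> //; last by rewrite addrA.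
  by rewrite memvD // (subvP (lcs_sub (isT : (2 <= 3)%N))).
pose A := br u (J z).
have JA : br v (J z) = J A by apply: br_center_J => p; apply: cen.
have brx3 p : br p x3 = br p A.
  by rewrite /x3 x2E brDr [LHS]brDr (cen (br u w)) ?add0r // lcsS_memr.
have brx5 p : br p x5 = br p (J A).
  by rewrite /x5 x2E brDr [LHS]brDr JA (cen (br v w)) ?add0r // lcsS_memr.
(* By Jacobi the difference is [[u, v], x2] = [x2, x2]. *)
have vu : br u x5 = br v x3.
  by apply/eqP; rewrite -subr_eq0 -br_jacobi brxx.
have E : br v (J A) - br u A = J (br v A + br u (J A)).
  by rewrite br_JJ linearD /= addrC -addrA addKr.
have br3 p x : x \in g 2 -> br p x \in g 3 by apply: lcsS_memr.
(* The sum is in the line g^3, and by [E] so is its image under J. *)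
have sum0 : br v A + br u (J A) = 0.
  apply: (J_line_eq0 (U := g 3)); rewrite ?D3 //.
    by rewrite -brx3 -brx5 memvD ?br3.
  by rewrite -E -brx3 -brx5 memvB ?br3.
have x13 : br v x3 = 0.
  move: sum0; rewrite -brx3 -brx5 vu -mulr2n => /eqP.
  by rewrite -scaler_nat scaler_eq0 pnatr_eq0 => /eqP.
have x15 : br v x5 = x4.
  by apply/eqP; rewrite /x4 -subr_eq0 brx3 brx5 E sum0 linear0.
have g2 : (g 2 <= <[x3]> + <[x5]> + g 3)%VS.
  exact (lcs_step x2g gen (lcs2_sub gen)).
have g3 : (g 3 <= <[x4]>)%VS.
  apply: lcsS_sub => x y yg.
  have /memv_addP[_ /memv_addP[_ /vlineP[a ->] [_ /vlineP[b ->] ->]] [r rg ->]] :=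
    subvP gen _ (memvf x).
  rewrite brDl (br12 r) // addr0.
  have /memv_addP[_ /memv_addP[_ /vlineP[c ->] [_ /vlineP[d ->] ->]] [t tg ->]] :=
    subvP g2 _ yg.
  rewrite brDr (cen t) // addr0 !brDl !brDr !brZl !brZr vu x13 x15.
  by rewrite !scaler0 addr0 add0r memvD // !memvZ ?memv_line.
apply: (@n63_iso u v x2 x3 x4 x5) => //.
- set S := span _.
  have inS x : x \in [:: u; v; x2; x3; x4; x5] -> (<[x]> <= S)%VS.
    by move=> h; rewrite -memvE memv_span.
  have g3S : (g 3 <= S)%VS by rewrite (subv_trans g3) ?inS ?inE ?eqxx ?orbT.
  have g2S : (g 2 <= S)%VS.
    by rewrite (subv_trans g2) // !subv_add !inS ?inE ?eqxx ?orbT.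
  have g1S : (g 1 <= S)%VS.
    by rewrite (subv_trans (lcs2_sub gen)) // subv_add inS ?inE ?eqxx ?orbT.
  by rewrite (subv_trans gen) // !subv_add !inS ?inE ?eqxx ?orbT.
- by rewrite vu.
- exact: br12.
- exact: br12.
- by apply: br12 => //; rewrite (subvP (lcs_sub (isT : (1 <= 2)%N))).
- by move=> x; apply: cen.
Qed.

(** * Dimension counts for a quasi-filiform algebra *)

Section QuasiFiliform.

Variable m : nat.
Hypothesis nil_m : is_nilindex br m.
Hypothesis dim_m : (m + 2 = \dim (fullv : {vspace V}))%N.

Let gm0 : g m = 0%VS. Proof. by case: nil_m. Qed.

Lemma lcs_eq0 j : (m <= j)%N -> \dim (g j) = 0%N.
Proof. by move=> /lcs_sub; rewrite gm0 subv0 => /eqP->; exact: dimv0. Qed.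

(** An equality would make the series constant from j on, so g^j = g^m = 0, against the minimality
    of m. *)
Lemma lcs_dim_lt j : (j < m)%N -> (\dim (g j.+1) < \dim (g j))%N.
Proof.
move=> jm; rewrite ltnNge; apply: contraL (jm) => le.
have e : g j = g j.+1 by apply/esym/eqP; rewrite eqEdim lcs_subS.
have [_ /(_ j jm)] := nil_m; rewrite -(lcs_stop e (ltnW jm)) gm0.
by rewrite eqxx.
Qed.

Lemma lcs_dim_excess i j : (i <= j <= m)%N ->
  (\dim (g j) + j <= \dim (g i) + i)%N.
Proof.
elim: j => [|j IH]; first by rewrite leqn0 => /andP[/eqP->].
case/andP=> ij jm; move: ij; rewrite leq_eqVlt => /predU1P[-> //|ij].
have := lcs_dim_lt jm; have := IH.
by rewrite -ltnS ij ltnW //= => /(_ isT); lia.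
Qed.

Lemma lcs_dim_ge i : (m - i <= \dim (g i))%N.
Proof.
case: (leqP i m) => im; last lia.
have := @lcs_dim_excess i m; rewrite im leqnn => /(_ isT).
by rewrite gm0 dimv0; lia.
Qed.

Lemma m_even : ~~ odd m.
Proof.
have := dim_stable_even JJ (fun x _ => memvf (J x)).
by rewrite -dim_m oddD addbF.
Qed.

Lemma m_gt1 : (1 < m)%N.
Proof.
case: (posnP m) => [m0|]; last by have := m_even; lia.
by have := lcs_eq0 (leqnn m); rewrite m0 [g 0]/= -dim_m addn2.
Qed.

(** The even number dim W_1 lies between m - 1 and m + 1, and m is even. *)
Lemma dim_W1 : \dim (W 1) = m.
Proof.
have V0 : fullv != 0%VS :> {vspace V} by rewrite -dimv_eq0 -dim_m; lia.
have lt : (\dim (W 1) < m + 2)%N.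
  rewrite ltnNge dim_m; apply: contra (W1_neq gm0 V0) => le.
  by rewrite eqEdim subvf.
have := W_even 1; have := lcs_dim_ge 1; have := dimvS (lcs_subW 1).
by have := m_even; lia.
Qed.

(** For u outside W_1 the sum is J-stable, so its dimension is even and greater than m, hence m +
    2. *)
Lemma exists_gen : exists u, (fullv <= <[u]> + <[J u]> + W 1)%VS.
Proof.
have /subvPn[u _ uW] : ~~ (fullv <= W 1)%VS.
  by apply/negP => /dimvS; rewrite dim_W1 -dim_m; lia.
exists u; set S := (_ + W 1)%VS.
have WS : (W 1 <= S)%VS by apply: addvSr.
have lt : (\dim (W 1) < \dim S)%N.
  rewrite ltnNge; apply: contra uW => le.
  have /eqP-> : W 1 == S by rewrite eqEdim WS.
  by rewrite (subvP (addvSl _ _)) // (subvP (addvSl _ _)) // memv_line.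
have evS : ~~ odd (\dim S) := dim_stable_even JJ (@add_lineJ_stable u 1).
suff /eqP-> : S == fullv by apply: subvv.
rewrite eqEdim subvf -dim_m; move: lt evS; rewrite dim_W1.
by have := m_even; lia.
Qed.

(** Here dim g^i = m - i for i > 0. By [W_vanish], W_2 differs from W_1, so parity forces dim W_2 =
    m - 2; parity again gives W_3 = W_2, which must then be 0. *)
Lemma m_eq2 : \dim (g 1) = m.-1 -> m = 2.
Proof.
move=> D1.
have D i : (0 < i)%N -> \dim (g i) = (m - i)%N.
  move=> i0; case: (leqP i m) => im; last by rewrite lcs_eq0 //; lia.
  have := lcs_dim_ge i; have := @lcs_dim_excess 1 i.
  rewrite i0 im D1 => /(_ isT).
  by have := m_gt1; lia.
have drop i : (0 < i)%N -> (\dim (g i) <= (\dim (g i.+1)).+1)%N.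
  by move=> i0; rewrite !D //; lia.
have W21 : \dim (W 2) = (m - 2)%N.
  have W12 : W 1 != W 2.
    apply/eqP => /(W_vanish gm0)/(_ (fun i h => drop i (ltnW h))) W0.
    by have := m_gt1; rewrite -dim_W1 W0 dimv0.
  have lt : (\dim (W 2) < \dim (W 1))%N.
    by rewrite ltnNge; apply: contra W12 => le; rewrite eq_sym eqEdim W_sub.
  have := dimvS (lcs_subW 2); have := W_even 2; have := m_even.
  by move: lt; rewrite dim_W1 D //; lia.
have /(W_vanish gm0) : W 2 = W 3.
  apply/esym/eqP; rewrite eqEdim W_sub // W21.
  have := dimvS (lcs_subW 3); have := W_even 3; have := m_even.
  by rewrite D //; lia.
move=> /(_ (fun i h => drop i (ltn_trans (isT : 0 < 2)%N h))) W0.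
by have := m_gt1; move: W21; rewrite W0 dimv0; lia.
Qed.

(** * The case where g^1 has codimension 2 *)

Section TwoGenerators.

Hypothesis D1 : \dim (g 1) = m.

Lemma W1_lcs : W 1 = g 1.
Proof. by apply/esym/eqP; rewrite eqEdim lcs_subW dim_W1 D1 leqnn. Qed.

(** Two generators modulo g^1 give a single bracket spanning g^1 modulo g^2. *)
Lemma dim_lcs2 : \dim (g 2) = m.-1.
Proof.
have [u] := exists_gen; rewrite W1_lcs => /lcs2_sub/dimvS.
move=> /leq_trans/(_ (dimv_add_leqif _ _)).
rewrite D1 dim_vline; have := lcs_dim_lt m_gt1; rewrite D1.
by have := leq_b1 (br u (J u) != 0); have := m_gt1; lia.
Qed.

Lemma W12 : W 1 = W 2.
Proof.
apply/esym/eqP; rewrite eqEdim W_sub // dim_W1.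
have := dimvS (lcs_subW 2); have := W_even 2; have := m_even.
by rewrite dim_lcs2; lia.
Qed.

(** The quantity dim g^j + j is nonincreasing for j up to m, from m + 1 at j = 1 to m at j = m; k is
    the last index with value m + 1. *)
Lemma exists_jump : exists k, [/\ (1 < k < m)%N,
  forall j, (0 < j <= k)%N -> \dim (g j) = (m - j).+1 &
  forall j, (k < j)%N -> \dim (g j) = (m - j)%N].
Proof.
have ex : exists j, (0 < j)%N && (\dim (g j) == m - j)%N.
  by exists m; rewrite lcs_eq0 // subnn eqxx andbT ltnW ?m_gt1.
case: (ex_minnP ex) => -[//|k] /eqP Dk kmin.
have k2 : (1 < k)%N.
  case: k Dk {kmin} => [|[|//]]; first by rewrite D1; have := m_gt1; lia.
  by rewrite dim_lcs2; have := m_gt1; lia.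
have km : (k < m)%N.
  apply: kmin; rewrite lcs_eq0 // subnn eqxx andbT; exact: ltnW m_gt1.
exists k; split; first by rewrite k2.
  move=> j /andP[j0 jk]; have := @lcs_dim_excess 1 j.
  rewrite j0 D1 (leq_trans jk (ltnW km)) => /(_ isT).
  have := lcs_dim_ge j; case: (\dim (g j) =P (m - j)%N) => [e|]; last lia.
  by have := kmin j; rewrite j0 e eqxx => /(_ isT); lia.
move=> j kj; case: (leqP j m) => jm; last by rewrite lcs_eq0 //; lia.
have := @lcs_dim_excess k.+1 j; rewrite kj jm => /(_ isT).
by have := lcs_dim_ge j; rewrite Dk; lia.
Qed.

(** * Locating the drop of dimension 2 *)

Section Jump.

Variable k : nat.
Hypothesis k_bound : (1 < k < m)%N.
Hypothesis D_le : forall j, (0 < j <= k)%N -> \dim (g j) = (m - j).+1.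
Hypothesis D_gt : forall j, (k < j)%N -> \dim (g j) = (m - j)%N.

Lemma W_le j : (0 < j <= k)%N -> W j = g 1.
Proof.
suff h i : (i.+2 <= k)%N -> W i.+1 = W 1 /\ W i.+2 = W 1.
  case: j => [//|[_|i ik]]; first exact: W1_lcs.
  by rewrite -W1_lcs; have [] := h i ik.
elim: i => [|i IH] ik; first by rewrite -W12.
have [W1i W2i] := IH (ltnW ik); split=> //.
rewrite -W2i; apply/esym/W_stationary; first by rewrite W1i W2i.
by rewrite !D_le; lia.
Qed.

Let Wk : W k = g 1. Proof. by apply: W_le; lia. Qed.

Lemma Wk_sub : (g 1 <= g k + W k.+1)%VS.
Proof.
case: k k_bound Wk => [//|[//|i]] h Wi; rewrite -Wi.
by apply: W_eq_lcs_add; rewrite Wi lcs_sub.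
Qed.

Lemma drop_gt i : (k < i)%N -> (\dim (g i) <= (\dim (g i.+1)).+1)%N.
Proof. by move=> ki; rewrite !D_gt //; lia. Qed.

(** [W_vanish] and parity give the upper bound; [Wk_sub] gives the lower one, as g^k adds to W_(k+1)
    at most the drop dim g^k - dim g^(k+1) = 2. *)
Lemma dim_WkS : \dim (W k.+1) = (m - 2)%N.
Proof.
have neq : W k != W k.+1.
  apply/eqP => /(W_vanish gm0)/(_ drop_gt) W0.
  by have := m_gt1; rewrite -D1 -Wk W0 dimv0.
have lt : (\dim (W k.+1) < \dim (W k))%N.
  by rewrite ltnNge; apply: contra neq => le; rewrite eq_sym eqEdim W_sub.
have := dimvS Wk_sub; have := dimv_sum_cap (g k) (W k.+1).
have : (\dim (g k.+1) <= \dim (g k :&: W k.+1)%VS)%N.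
  by rewrite dimvS // subv_cap lcs_subS lcs_subW.
have := W_even k.+1; have := m_even; move: lt.
rewrite Wk D1 D_gt // D_le; last lia.
by lia.
Qed.

Lemma lcs_capW : (g k :&: W k.+1 <= g k.+1)%VS.
Proof.
have sub : (g k.+1 <= g k :&: W k.+1)%VS by rewrite subv_cap lcs_subS lcs_subW.
suff /eqP<- : g k.+1 == (g k :&: W k.+1)%VS by apply: subvv.
rewrite eqEdim sub; have := dimvS Wk_sub; have := dimv_sum_cap (g k) (W k.+1).
by rewrite dim_WkS D1 (D_gt (ltnSn k)) (@D_le k); lia.
Qed.

Lemma drop1_line i : (0 < i)%N -> (\dim (g i) <= (\dim (g i.+1)).+1)%N ->
  forall y, y \in g i -> y \notin g i.+1 -> (g i <= <[y]> + g i.+1)%VS.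
Proof.
move=> i0 drop y yg yn; set S := (_ + _)%VS.
have Sg : (S <= g i)%VS by rewrite subv_add -memvE yg lcs_subS.
suff /eqP-> : g i == S by apply: subvv.
rewrite eq_sym eqEdim Sg (leq_trans drop) // ltnNge; apply: contra yn => le.
have /eqP-> : g i.+1 == S by rewrite eqEdim addvSr.
by rewrite (subvP (addvSl _ _)) // memv_line.
Qed.

(** If k > 2, take y spanning g^(k-2) modulo g^(k-1) and generators P, Q with [Q, y] in g^k. Then
    [P, [P, y]] alone spans g^k modulo g^(k+1), against the drop of 2. *)
Lemma jump_eq2 : k = 2.
Proof.
case: k k_bound D_le D_gt Wk lcs_capW => [//|[//|[//|i]]] kb Dle Dgt Wi capW.
have /subvPn[y yg yn] : ~~ (g i.+1 <= g i.+2)%VS.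
  by apply/negP => /dimvS; rewrite !Dle; lia.
have geny : (g i.+1 <= <[y]> + g i.+2)%VS.
  by apply: drop1_line => //; rewrite !Dle; lia.
have [u gen] := exists_gen; rewrite W1_lcs in gen.
have [P [Q [genPQ Qy]]] : exists P Q,
    (fullv <= <[P]> + <[Q]> + g 1)%VS /\ br Q y \in g i.+3.
  case: (boolP (br (J u) y \in g i.+3)) => [h|h]; first by exists u, (J u).
  have drop : (\dim (g i.+2) <= (\dim (g i.+3)).+1)%N by rewrite !Dle; lia.
  (* Now [Ju, y] spans g^(k-1) modulo g^k, so [u, y] = c [Ju, y] there, and u - c Ju can serve as
     Q. *)
  have /subvP/(_ _ (lcsS_memr u yg)) :=
    drop1_line (ltn0Sn i.+1) drop (lcsS_memr _ yg) h.
  case/memv_addP=> _ /vlineP[c ->] [t tg e].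
  exists (J u), (u - c *: J u); split; last first.
    by rewrite brDl brNl brZl e addrC addKr.
  apply: subv_trans gen _; rewrite !subv_add addvSr andbT -!memvE.
  apply/andP; split; apply: (subvP (addvSl _ _)); last first.
    by rewrite (subvP (addvSl _ _)) ?memv_line.
  rewrite -{1}(subrK (c *: J u) u) addrC.
  by rewrite memv_add ?memvZ ?memv_line.
have genP : (g i.+2 <= <[br P y]> + g i.+3)%VS.
  apply: subv_trans (lcs_step yg genPQ geny) _.
  by rewrite !subv_add addvSl addvSr -memvE (subvP (addvSr _ _)).
have := lcs_step (lcsS_memr P yg) genPQ genP.
(* ad P and ad Q commute on y modulo [g^1, g^1], hence modulo g^(k+1), so
   ad P (ad P y) alone spans g^k modulo g^(k+1). *)
have QPy : br Q (br P y) \in g i.+4.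
  have -> : br Q (br P y) = br (br Q P) y + br P (br Q y).
    by rewrite br_jacobi subrK.
  rewrite memvD ?(lcsS_memr P Qy) // (subvP capW) // memv_cap.
  have QP1 : br Q P \in g 1 by apply: (@lcsS_memr 0); apply: memvf.
  rewrite lcs1_br // br_W // Wi // (subvP (lcs_sub (ltn0Sn i))) //.
rewrite -addvA => /dimvS; rewrite (_ : <[br Q _]> + _ = g i.+4)%VS; last first.
  by apply/addv_idPr.
move=> /leq_trans/(_ (dimv_add_leqif _ _)).
rewrite dim_vline (Dgt _ (leqnn i.+4)) Dle; last lia.
by have := leq_b1 (br P (br P y) != 0); lia.
Qed.

End Jump.

Lemma m_eq4 : [/\ m = 4, \dim (g 3) = 1%N & (g 1 <= g 2 + W 3)%VS].
Proof.
have [k [kb Dle Dgt]] := exists_jump.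
have k2 := jump_eq2 kb Dle Dgt; rewrite k2 in kb Dle Dgt.
have dW3 := dim_WkS kb Dle Dgt.
have W43 : (\dim (W 4) < \dim (W 3))%N.
  rewrite ltnNge; apply/negP => le.
  have e : W 3 = W 4 by apply/esym/eqP; rewrite eqEdim W_sub.
  have := W_vanish gm0 e; move: dW3 => /[swap] ->; first by rewrite dimv0; lia.
  by move=> i h; apply: drop_gt Dgt _ _; lia.
have dW4 : \dim (W 4) = (m - 4)%N.
  have := dimvS (lcs_subW 4); have := W_even 4; have := m_even.
  by move: W43; rewrite dW3 Dgt //; lia.
have W45 : W 4 = W 5.
  apply/esym/eqP; rewrite eqEdim W_sub // dW4.
  have := dimvS (lcs_subW 5); have := W_even 5; have := m_even.
  by rewrite Dgt //; lia.
have W4 : W 4 = 0%VS.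
  by apply: W_vanish gm0 W45 _ => i h; apply: drop_gt Dgt _ _; lia.
(* Subtraction is truncated, so W_4 = 0 only gives m <= 4; 2 < m and parity finish. *)
have m4 : m = 4 by move: dW4 m_even; rewrite W4 dimv0; lia.
split=> //; first by rewrite Dgt // m4.
exact: Wk_sub kb Dle.
Qed.

End TwoGenerators.

End QuasiFiliform.

End Complex.

End LieTheory.

Theorem theorem3 (R : realType) (V : vectType R) (br : V -> V -> V) :
  lie_algebra br -> quasi_filiform br ->
  (exists J : 'End(V), complex_structure br J) ->
  lie_iso br (@L3R_bracket R) \/ lie_iso br (@n63_bracket R).
Proof.
move=> lie [m [nil_m dim_m]] [J cpx].
have [u gen] := exists_gen lie cpx nil_m dim_m.
have m1 := m_gt1 lie cpx nil_m dim_m; have dW1 := dim_W1 lie cpx nil_m dim_m.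
have := dimvS (lcs_subW br J 1); have := lcs_dim_ge lie nil_m dim_m 1.
rewrite dW1.
(* The bounds m - 1 <= dim g^1 <= dim W_1 = m leave two values. *)
case: (\dim (lcs br 1) =P m) => [D1 _ _|nD1 lo hi].
  have [m4 D3 g1W] := m_eq4 lie cpx nil_m dim_m D1.
  rewrite (W1_lcs lie cpx nil_m dim_m D1) in gen.
  have [g4 _] := nil_m; rewrite m4 in g4.
  by right; apply: (iso_n63 lie cpx _ D3 g4 g1W gen); rewrite -dim_m m4.
have D1 : \dim (lcs br 1) = m.-1 by lia.
have m2 := m_eq2 lie cpx nil_m dim_m D1; have [g2 _] := nil_m; rewrite m2 in g2.
by left; apply: (iso_L3R lie cpx _ _ g2 gen); rewrite -?dim_m ?D1 m2.
Qed.
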